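(* Let $\aleph$ be an infinite cardinal, $\mathbb K$ a field, and $I$ an $\aleph$-poset having a finite cofinal subset. Given a subset $J$ of $I$, the assignment $L\mapsto H(I,L)$ defines a lattice isomorphism from the lattice of all lower subsets of $J$ (ordered by inclusion) to the lattice of all (two-sided) ideals of the $\mathbb K$-algebra $H(I,J)$ (ordered by inclusion). In particular, the lattice of all ideals of $\mathfrak B(I)$ is isomorphic to the lattice of all lower subsets of $I$.
   Context: Conventions. $\aleph$ is an infinite cardinal, regarded as an initial ordinal, so that $\emptyset\in\aleph$; $\mathbb K$ is a field. For a poset $P$, $\mathcal M(P)$ is the set of all maximal chains of $P$ (maximal totally ordered subsets). An $\aleph$-poset is a partially ordered set $I$ with $|I|\le\aleph$ and $|\mathcal M(I)|\le\aleph$. For $i\in I$: $\{i\le\}=\{k\in I: i\le k\}$, $\{\le i\}=\{k\in I:k\le i\}$, $\{i\not\le\}=I\setminus\{i\le\}$, with the induced orders. A lower subset of a poset $J$ is a subset $L\subseteq J$ such that $j\in J$, $l\in L$, $j\le l$ imply $j\in L$. For a set $A$, $\aleph^{(A)}$ is the set of maps $p:A\to\aleph$ with $p(a)=\emptyset$ for all but finitely many $a\in A$. For a set $X$, $\mathrm{CFM}_X(\mathbb K)$ is the $\mathbb K$-algebra of column-finite $X\times X$ matrices over $\mathbb K$, and $\mathrm{FR}_X(\mathbb K)$ is its ideal of matrices with only finitely many nonzero rows; $a(x,y)$ denotes the entry of $a$ in row $x$, column $y$. Construction. Let $X(I)=\aleph^{(I)}\times\mathcal M(I)$ and $Q(I)=\mathrm{CFM}_{X(I)}(\mathbb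 K)$. For $i\in I$ let $X(i\le)=\aleph^{(\{i\le\})}\times\mathcal M(\{i\le\})$ and let $\psi_{I,i}:\mathrm{CFM}_{X(i\le)}(\mathbb K)\to Q(I)$ be the injective (not necessarily unital) $\mathbb K$-algebra homomorphism given, for $p,q\in\aleph^{(I)}$ and $A,B\in\mathcal M(I)$, by $$\psi_{I,i}(a)((p,A),(q,B))=a\big((p|_{\{i\le\}},A\cap\{i\le\}),(q|_{\{i\le\}},B\cap\{i\le\})\big)$$ if $i\in A\cap B$, $A\cap\{\le i\}=B\cap\{\le i\}$ and $p|_{\{i\not\le\}}=q|_{\{i\not\le\}}$, and $\psi_{I,i}(a)((p,A),(q,B))=0$ otherwise. Put $H(I,i)=\psi_{I,i}(\mathrm{FR}_{X(i\le)}(\mathbb K))$ if $i$ is not a maximal element of $I$, and $H(I,i)=\mathbb K\,\psi_{I,i}(\mathbf 1)$ if $i$ is a maximal element of $I$. For $J\subseteq I$ put $H(I,J)=\sum_{j\in J}H(I,j)\subseteq Q(I)$; this sum is direct and $H(I,J)$ is a (not necessarily unital) $\mathbb K$-subalgebra of $Q(I)$. Finally $\mathfrak B(I)=H(I,I)$, which is a unital subalgebra of $Q(I)$ when $I$ has a finite cofinal subset. *)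

(* Defs.v *)
From HB Require Import structures.
From mathcomp Require Import all_boot all_order all_algebra.
From mathcomp Require Import all_classical.

Set Implicit Arguments.
Unset Strict Implicit.
Unset Printing Implicit Defensive.

Import Order.TTheory GRing.Theory.
Local Open Scope classical_set_scope.
Local Open Scope ring_scope.

Lemma fsum_neq0 (V : nmodType) (T : choiceType) (D : set T) (F : T -> V) :
  \sum_(z \in D) F z != 0 -> exists2 z, D z & F z != 0.
Proof.
apply: contra_neqP => /forall2NP DF; apply: fsbig1 => z Dz.
by case: (DF z) => // /negP/negPn/eqP.
Qed.

(* [X] is pointed only so that [cfm] is a nonzero ring, as [algType] asks. *)
Section ColumnFiniteMatrices.
Variables (K : fieldType) (X : pointedType).

Record cfm := CFM {
  cfm_entry :> X -> X -> K;
  cfm_colfin : forall y, finite_set [set x | cfm_entry x y != 0] }.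

HB.instance Definition _ := gen_eqMixin cfm.
HB.instance Definition _ := gen_choiceMixin cfm.

Lemma cfmP (a b : cfm) : (forall x y, a x y = b x y) -> a = b.
Proof.
case: a b => [a fa] [b fb] /= ab.
have eab : a = b by apply/funext => x; apply/funext => y; exact: ab.
by subst b; congr CFM; exact: Prop_irrelevance.
Qed.

Fact cfm0_colfin y : finite_set [set x : X | (fun _ _ : X => 0 : K) x y != 0].
Proof. by apply: (sub_finite_set _ (@finite_set0 X)) => x /=; rewrite eqxx. Qed.
Definition cfm0 := CFM cfm0_colfin.

Fact cfmD_colfin (a b : cfm) y : finite_set [set x | a x y + b x y != 0].
Proof.
apply: (@sub_finite_set _ _ ([set x | a x y != 0] `|` [set x | b x y != 0])).
  move=> x /=; have [->|] := eqVneq (a x y) 0; last by left.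
  by rewrite add0r; right.
by rewrite finite_setU; split; exact: cfm_colfin.
Qed.
Definition cfmD a b := CFM (cfmD_colfin a b).

Fact cfmN_colfin (a : cfm) y : finite_set [set x | - a x y != 0].
Proof.
by apply: sub_finite_set (cfm_colfin a y) => x /=; rewrite oppr_eq0.
Qed.
Definition cfmN a := CFM (cfmN_colfin a).

Fact cfmZ_colfin (c : K) (a : cfm) y : finite_set [set x | c * a x y != 0].
Proof.
by apply: sub_finite_set (cfm_colfin a y) => x /=; rewrite mulf_eq0 => /norP[].
Qed.
Definition cfmZ c a := CFM (cfmZ_colfin c a).

Fact cfm1_colfin y : finite_set [set x : X | (x == y)%:R != 0 :> K].
Proof.
apply: (sub_finite_set _ (finite_set1 y)) => x /=.
have [->//|_] := eqVneq x y; by rewrite eqxx.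
Qed.
Definition cfm1 := CFM cfm1_colfin.

Fact cfmM_colfin (a b : cfm) y :
  finite_set [set x | \sum_(z \in [set: X]) a x z * b z y != 0].
Proof.
apply: (@sub_finite_set _ _
  (\bigcup_(z in [set z | b z y != 0]) [set x | a x z != 0])).
  move=> x /= /fsum_neq0 [z _]; rewrite mulf_eq0 => /norP[az bz].
  by exists z.
by apply: bigcup_finite => [|z _]; exact: cfm_colfin.
Qed.
Definition cfmM a b := CFM (cfmM_colfin a b).

Fact cfmDA : associative cfmD.
Proof. by move=> a b c; apply: cfmP => x y /=; rewrite addrA. Qed.
Fact cfmDC : commutative cfmD.
Proof. by move=> a b; apply: cfmP => x y /=; rewrite addrC. Qed.
Fact cfm0D : left_id cfm0 cfmD.
Proof. by move=> a; apply: cfmP => x y /=; rewrite add0r. Qed.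
Fact cfmND : left_inverse cfm0 cfmN cfmD.
Proof. by move=> a; apply: cfmP => x y /=; rewrite addNr. Qed.

HB.instance Definition _ := GRing.isZmodule.Build cfm cfmDA cfmDC cfm0D cfmND.

Lemma cfmM_widen (a b : cfm) x y (D : set X) :
  [set z | b z y != 0] `<=` D ->
  \sum_(z \in [set: X]) a x z * b z y = \sum_(z \in D) a x z * b z y.
Proof.
move=> bD; apply/esym/fsbig_widen => // z [_ nDz] /=.
have [->|bz] := eqVneq (b z y) 0; first by rewrite mulr0.
by case: nDz; exact: bD.
Qed.

Fact cfmMA : associative cfmM.
Proof.
move=> a b c; apply: cfmP => x y /=.
pose W := [set w | c w y != 0].
pose Z := \bigcup_(w in W) [set z | b z w != 0].
have fW : finite_set W by exact: cfm_colfin.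
have fZ : finite_set Z by apply: bigcup_finite => // w _; exact: cfm_colfin.
rewrite (@cfmM_widen (cfmM a b) c x y W)//.
rewrite (@cfmM_widen a (cfmM b c) x y Z); last first.
  move=> z /= /fsum_neq0 [w _]; rewrite mulf_eq0 => /norP[bz cw].
  by exists w.
transitivity (\sum_(z \in Z) \sum_(w \in W) a x z * b z w * c w y).
  apply: eq_fsbigr => z _ /=; rewrite (@cfmM_widen b c z y W)//.
  by rewrite mulr_fsumr; apply: eq_fsbigr => w _; rewrite mulrA.
rewrite exchange_fsbig//; apply: eq_fsbigr => w /set_mem Ww /=.
rewrite -mulr_fsuml; congr (_ * _).
by rewrite -cfmM_widen// => z bz; exists w.
Qed.

Fact cfm1M : left_id cfm1 cfmM.
Proof.
move=> a; apply: cfmP => x y /=.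
rewrite -(@fsbig_widen _ _ _ _ [set x])//= ?fsbig_set1 ?eqxx ?mul1r//.
by move=> z [_ /= /eqP]; rewrite eq_sym => /negbTE->; rewrite mul0r.
Qed.

Fact cfmM1 : right_id cfm1 cfmM.
Proof.
move=> a; apply: cfmP => x y /=.
rewrite -(@fsbig_widen _ _ _ _ [set y])//= ?fsbig_set1 ?eqxx ?mulr1//.
by move=> z [_ /= /eqP] /negbTE->; rewrite mulr0.
Qed.

Fact cfmMDl : left_distributive cfmM cfmD.
Proof.
move=> a b c; apply: cfmP => x y /=.
rewrite (@cfmM_widen (cfmD a b) c x y [set z | c z y != 0])//.
rewrite (@cfmM_widen a c x y [set z | c z y != 0])//.
rewrite (@cfmM_widen b c x y [set z | c z y != 0])//.
rewrite -fsbig_split; last exact: cfm_colfin.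
by apply: eq_fsbigr => z _ /=; rewrite mulrDl.
Qed.

Fact cfmMDr : right_distributive cfmM cfmD.
Proof.
move=> a b c; apply: cfmP => x y /=.
pose D := [set z | b z y != 0] `|` [set z | c z y != 0].
rewrite (@cfmM_widen a (cfmD b c) x y D); last first.
  move=> z /=; have [->|] := eqVneq (b z y) 0; last by left.
  by rewrite add0r; right.
rewrite (@cfmM_widen a b x y D); last by move=> z; left.
rewrite (@cfmM_widen a c x y D); last by move=> z; right.
rewrite -fsbig_split; last by rewrite finite_setU; split; exact: cfm_colfin.
by apply: eq_fsbigr => z _ /=; rewrite mulrDr.
Qed.

Fact cfm1_neq0 : cfm1 != 0.
Proof.
apply/eqP => /(congr1 (fun a : cfm => a point point)) /=.
by rewrite eqxx => /eqP; rewrite oner_eq0.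
Qed.

HB.instance Definition _ := GRing.Zmodule_isNzRing.Build cfm
  cfmMA cfm1M cfmM1 cfmMDl cfmMDr cfm1_neq0.

Fact cfmZA a b v : cfmZ a (cfmZ b v) = cfmZ (a * b) v.
Proof. by apply: cfmP => x y /=; rewrite mulrA. Qed.
Fact cfm1Z : left_id 1 cfmZ.
Proof. by move=> v; apply: cfmP => x y /=; rewrite mul1r. Qed.
Fact cfmZDr : right_distributive cfmZ +%R.
Proof. by move=> c u v; apply: cfmP => x y /=; rewrite mulrDr. Qed.
Fact cfmZDl v : {morph cfmZ^~ v : a b / a + b}.
Proof. by move=> a b; apply: cfmP => x y /=; rewrite mulrDl. Qed.

HB.instance Definition _ := GRing.Zmodule_isLmodule.Build K cfm
  cfmZA cfm1Z cfmZDr cfmZDl.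

Fact cfmZAl c (u v : cfm) : c *: (u * v) = (c *: u) * v.
Proof.
apply: cfmP => x y; rewrite /GRing.scale /GRing.mul /= mulr_fsumr.
by apply: eq_fsbigr => z _; rewrite mulrA.
Qed.
Fact cfmZAr c (u v : cfm) : c *: (u * v) = u * (c *: v).
Proof.
apply: cfmP => x y; rewrite /GRing.scale /GRing.mul /= mulr_fsumr.
by apply: eq_fsbigr => z _; rewrite mulrCA.
Qed.

HB.instance Definition _ := GRing.Lmodule_isLalgebra.Build K cfm cfmZAl.
HB.instance Definition _ := GRing.Lalgebra_isAlgebra.Build K cfm cfmZAr.

Lemma cfm0E x y : (0 : cfm) x y = 0. Proof. by []. Qed.
Lemma cfmDE (a b : cfm) x y : (a + b) x y = a x y + b x y. Proof. by []. Qed.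
Lemma cfmZE c (a : cfm) x y : (c *: a) x y = c * a x y. Proof. by []. Qed.
Lemma cfm1E x y : (1 : cfm) x y = (x == y)%:R. Proof. by []. Qed.
Lemma cfmME (a b : cfm) x y :
  (a * b) x y = \sum_(z \in [set: X]) a x z * b z y.
Proof. by []. Qed.

Definition FR : set cfm :=
  [set a | finite_set [set x | exists y, a x y != 0]].

Lemma FR0 : FR 0.
Proof.
by apply: (sub_finite_set _ (@finite_set0 X)) => x [y]; rewrite cfm0E eqxx.
Qed.

Lemma FRD a b : FR a -> FR b -> FR (a + b).
Proof.
move=> fa fb; have : finite_set ([set x | exists y, a x y != 0] `|`
    [set x | exists y, b x y != 0]) by rewrite finite_setU.
apply: sub_finite_set => x [y]; rewrite cfmDE.
have [->|a0 _] := eqVneq (a x y) 0; last by left; exists y.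
by rewrite add0r => b0; right; exists y.
Qed.

Lemma FRZ c a : FR a -> FR (c *: a).
Proof.
apply: sub_finite_set => x [y]; rewrite cfmZE mulf_eq0 => /norP[_ axy].
by exists y.
Qed.

Lemma FRMr a b : FR a -> FR (a * b).
Proof.
apply: sub_finite_set => x [y]; rewrite cfmME => /fsum_neq0 [z _].
by rewrite mulf_eq0 => /norP[axz _]; exists z.
Qed.

Lemma FRMl a b : FR a -> FR (b * a).
Proof.
move=> fa; apply: (@sub_finite_set _ _
  (\bigcup_(z in [set z | exists y, a z y != 0]) [set x | b x z != 0])).
  move=> x [y]; rewrite cfmME => /fsum_neq0 [z _].
  by rewrite mulf_eq0 => /norP[bxz azy]; exists z => //; exists y.
by apply: bigcup_finite => // z _; exact: cfm_colfin.
Qed.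

End ColumnFiniteMatrices.

Section MaximalChains.
Variables (d : Order.disp_t) (P : porderType d).

Definition is_chain (A : set P) := total_on A (fun a b => (a <= b)%O).

Definition maxchains : set (set P) :=
  [set A | is_chain A /\ forall B, is_chain B -> A `<=` B -> B = A].

Record maxchain := MaxChain {
  mc_set :> set P;
  mc_max : maxchains mc_set }.

HB.instance Definition _ := gen_eqMixin maxchain.
HB.instance Definition _ := gen_choiceMixin maxchain.

Lemma maxchainP (A B : maxchain) : A = B :> set P -> A = B.
Proof.
case: A B => [A mA] [B mB] /= AB; subst B.
by congr MaxChain; exact: Prop_irrelevance.
Qed.

Lemma ex_maxchain (C : set P) : is_chain C ->
  exists2 A, maxchains A & C `<=` A.
Proof.
move=> cC; have [F FS totF|A [cA mA]] :=
  @Zorn_bigcup _ [set A | is_chain (A `|` C)].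
- move=> a b [[A FA Aa]|Ca] [[B FB Bb]|Cb].
  + have [AB|BA] := totF _ _ FA FB.
      by apply: (FS _ FB); left => //; exact: AB.
    by apply: (FS _ FA); left => //; exact: BA.
  + by apply: (FS _ FA); [left|right].
  + by apply: (FS _ FB); [right|left].
  + exact: cC.
exists (A `|` C); last by move=> x; right.
split=> // B cB ACB; apply/seteqP; split=> // x Bx; apply: contrapT => nACx.
apply: (mA B); first split.
- by move=> y Ay; apply: ACB; left.
- by move=> /(_ _ Bx) Ax; apply: nACx; left.
- by rewrite /= setUidl// => y Cy; apply: ACB; right.
Qed.

Lemma maxchains0 : exists A : set P, maxchains A.
Proof. by have [|A mA _] := @ex_maxchain set0; [move=> ? ? []|exists A]. Qed.

HB.instance Definition _ := isPointed.Build maxchain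
  (MaxChain (projT2 (cid maxchains0))).

Lemma maxchainU (A : maxchain) (B : set P) :
  is_chain (mc_set A `|` B) -> B `<=` mc_set A.
Proof.
case: A => A [cA mA] /= cAB; have <- : A `|` B = A; last by move=> x; right.
by apply: mA => // x; left.
Qed.

Lemma mc_tot (A : maxchain) a b :
  mc_set A a -> mc_set A b -> (a <= b)%O \/ (b <= a)%O.
Proof. by case: A => A [cA mA] /=; exact: cA. Qed.

End MaximalChains.

Definition up d (P : porderType d) (i : P) := {k : P | (i <= k)%O}.

HB.instance Definition _ d (P : porderType d) (i : P) :=
  SubChoice.copy (up i) {k : P | (i <= k)%O}.
HB.instance Definition _ d (P : porderType d) (i : P) :=
  [SubChoice_isSubPOrder of up i by <: with d].

Section IndexSet.
Variables (aleph : pointedType) (d : Order.disp_t) (P : porderType d).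

(* [aleph] is a set of the given cardinality, and its distinguished point plays
   the role of the least ordinal; the order on ordinals is not used. *)
Record alephfun := AlephFun {
  af_fun :> P -> aleph;
  af_fin : finite_set [set k | af_fun k != point] }.

HB.instance Definition _ := gen_eqMixin alephfun.
HB.instance Definition _ := gen_choiceMixin alephfun.

Lemma alephfunP (p q : alephfun) : (forall k, p k = q k) -> p = q.
Proof.
case: p q => [p fp] [q fq] /= /funext pq; subst q.
by congr AlephFun; exact: Prop_irrelevance.
Qed.

Fact alephfun0_fin : finite_set [set k : P | (point : aleph) != point].
Proof. by apply: (sub_finite_set _ (@finite_set0 P)) => x /=; rewrite eqxx. Qed.

HB.instance Definition _ := isPointed.Build alephfun (AlephFun alephfun0_fin).

Definition X := (alephfun * maxchain P)%type.
HB.instance Definition _ := Pointed.copy X (alephfun * maxchain P)%type.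

End IndexSet.

Section Restriction.
Variables (aleph : pointedType) (d : Order.disp_t) (P : porderType d) (i : P).

Fact restr_fun_fin (p : alephfun aleph P) :
  finite_set [set k : up i | p (val k) != point].
Proof.
apply: (@finite_preimage _ _ [set k | p k != point] (val : up i -> P)).
  by move=> x y _ _; exact: val_inj.
exact: af_fin.
Qed.
Definition restr_fun (p : alephfun aleph P) : alephfun aleph (up i) :=
  AlephFun (restr_fun_fin p).

Lemma restr_chain_max (A : maxchain P) : mc_set A i ->
  maxchains [set k : up i | mc_set A (val k)].
Proof.
move=> Ai; split=> [a b /= Aa Ab|B cB AB]; first exact: (mc_tot Aa Ab).
apply/seteqP; split=> // b Bb.
apply: (@maxchainU _ _ A (val @` B)); last by exists b.
move=> x y [Ax|[x' Bx <-]] [Ay|[y' By <-]].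
- exact: (mc_tot Ax Ay).
- have [ix|xi] := mc_tot Ai Ax.
    by apply: (cB (exist _ x ix) y') => //; exact: AB.
  by left; exact: le_trans xi (valP y').
- have [iy|yi] := mc_tot Ai Ay.
    by apply: (cB x' (exist _ y iy)) => //; exact: AB.
  by right; exact: le_trans yi (valP x').
- exact: (cB x' y').
Qed.

(* The trace of [A] on [up i] is a maximal chain only if [A] contains [i]. *)
Definition restr_chain (A : maxchain P) : maxchain (up i) :=
  if pselect (mc_set A i) is left Ai then MaxChain (restr_chain_max Ai) else point.

Definition restr (x : X aleph P) : X aleph (up i) :=
  (restr_fun x.1, restr_chain x.2).

Lemma restr_chainE (A : maxchain P) : mc_set A i ->
  restr_chain A = [set k : up i | mc_set A (val k)] :> set (up i).
Proof. by rewrite /restr_chain; case: pselect. Qed.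

(* The condition under which the entry of [psi i a] at (x, y) is read off [a];
   a partial equivalence relation, with [glue x] parametrizing the class of x. *)
Definition linked (x y : X aleph P) : Prop :=
  [/\ mc_set x.2 i, mc_set y.2 i,
      mc_set x.2 `&` [set k | k <= i]%O = mc_set y.2 `&` [set k | k <= i]%O &
      forall k, ~~ (i <= k)%O -> x.1 k = y.1 k].

Lemma linked_refl x y : linked x y -> linked x x.
Proof. by case. Qed.

Lemma linked_sym x y : linked x y -> linked y x.
Proof. by case=> xi yi c f; split=> // k ik; rewrite f. Qed.

Lemma linked_trans x y z : linked x y -> linked y z -> linked x z.
Proof.
case=> xi yi c f [_ zi c' f']; split=> //; first by rewrite c.
by move=> k ik; rewrite f// f'.
Qed.

Lemma restr_inj x y : linked x y -> restr x = restr y -> x = y.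
Proof.
case: x y => [p A] [q B] [/= Ai Bi AB pq] [efun echain].
congr pair.
  apply: alephfunP => k; have [ik|] := boolP (i <= k)%O; last exact: pq.
  exact: (congr1 (fun f => f (exist _ k ik)) efun).
apply: maxchainP; have {}echain : restr_chain A = restr_chain B :> set _.
  by rewrite echain.
move: echain; rewrite !restr_chainE// => echain.
have iff k : (i <= k)%O -> mc_set A k = mc_set B k.
  by move=> ik; exact: (congr1 (fun f : set (up i) => f (exist _ k ik)) echain).
apply/seteqP; split=> k kAB.
  have [ik|ki] := mc_tot Ai kAB; first by rewrite -iff.
  by have [] : (mc_set B `&` [set k | k <= i]%O) k by rewrite -AB.
have [ik|ki] := mc_tot Bi kAB; first by rewrite iff.
by have [] : (mc_set A `&` [set k | k <= i]%O) k by rewrite AB.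
Qed.

Fact glue_fun_fin (p : alephfun aleph P) (q : alephfun aleph (up i)) :
  finite_set [set k | (if insub k is Some u then q u else p k) != point].
Proof.
apply: (@sub_finite_set _ _ ([set k | p k != point] `|`
    val @` [set u | q u != point])).
  by move=> k /=; case: insubP => [u _ <- qu|_ pk]; [right; exists u|left].
by rewrite finite_setU; split; [|apply: finite_image]; exact: af_fin.
Qed.

Definition glue_fun p q := AlephFun (@glue_fun_fin p q).

Lemma glue_chain_max (A : maxchain P) (C : maxchain (up i)) : mc_set A i ->
  maxchains ((mc_set A `&` [set k | k <= i]%O) `|` val @` mc_set C).
Proof.
move=> Ai; set AC := _ `|` _.
have Ci : mc_set C (exist _ i (lexx i)).
  apply: (@maxchainU _ _ C [set exist _ i (lexx i)]) => //.
  move=> x y [Cx|->] [Cy|->].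
  - exact: mc_tot Cx Cy.
  - by right; exact: (valP x).
  - by left; exact: (valP y).
  - by left.
split=> [x y|B cB ACB].
  case=> [[Ax xi]|[x' Cx <-]] [[Ay yi]|[y' Cy <-]].
  - exact: mc_tot Ax Ay.
  - by left; exact: le_trans xi (valP y').
  - by right; exact: le_trans yi (valP x').
  - exact: (mc_tot Cx Cy).
have Bi : B i by apply: ACB; left; split => //=.
apply/seteqP; split=> // b Bb; have [ib|bi] := cB _ _ Bi Bb.
  right; exists (exist _ b ib) => //.
  apply: (@maxchainU _ _ C [set exist _ b ib]) => //.
  move=> x y Cx Cy.
  suff Bv z : (mc_set C `|` [set exist _ b ib]) z -> B (val z).
    by apply: (cB (val x) (val y)); exact: Bv.
  by case=> [Cz|->//]; apply: ACB; right; exists z.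
left; split=> //; apply: (@maxchainU _ _ A [set b]) => //.
have cmp z : mc_set A z -> (z <= b)%O \/ (b <= z)%O.
  move=> Az; have [iz|zi] := mc_tot Ai Az.
    by right; exact: le_trans bi iz.
  by apply: cB => //; apply: ACB; left.
move=> x y [Ax|->] [Ay|->].
- exact: mc_tot Ax Ay.
- exact: cmp.
- by apply/or_comm; exact: cmp.
- by left.
Qed.

Definition glue_chain (A : maxchain P) (C : maxchain (up i)) : maxchain P :=
  if pselect (mc_set A i) is left Ai then MaxChain (glue_chain_max C Ai)
  else point.

Definition glue (x : X aleph P) (u : X aleph (up i)) : X aleph P :=
  (glue_fun x.1 u.1, glue_chain x.2 u.2).

Lemma glue_chainE (A : maxchain P) (C : maxchain (up i)) : mc_set A i ->
  glue_chain A C =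
    (mc_set A `&` [set k | k <= i]%O) `|` val @` mc_set C :> set P.
Proof. by rewrite /glue_chain; case: pselect. Qed.

Lemma linked_glue x u : mc_set x.2 i -> linked x (glue x u).
Proof.
case: x u => [p A] [q C] /= Ai; split=> //=; rewrite ?glue_chainE//.
- by left; split => //=.
- apply/seteqP; split=> k [kA /= ki]; first by split => //; left.
  split=> //; case: kA => [[]//|[k' Ck' kk']].
  have -> // : k = i.
  by apply/eqP; rewrite eq_le ki -kk' (valP k').
- by move=> k ik; rewrite /= insubN.
Qed.

Lemma glueK x u : mc_set x.2 i -> restr (glue x u) = u.
Proof.
case: x u => [p A] [q C] /= Ai; congr pair.
  by apply: alephfunP => k /=; rewrite valK.
apply: maxchainP; rewrite restr_chainE; last first.
  by rewrite glue_chainE//; left; split => //=.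
rewrite /= glue_chainE//; apply/seteqP; split=> [k /= [[Ak ki]|]|k Ck].
- have -> : k = exist _ i (lexx i).
    by apply: val_inj; apply/eqP; rewrite eq_le ki (valP k).
  have [_ mC] := mc_max C.
  apply: (@maxchainU _ _ C [set exist _ i (lexx i)]) => //.
  move=> x y [Cx|->] [Cy|->].
  + exact: mc_tot Cx Cy.
  + by right; exact: (valP x).
  + by left; exact: (valP y).
  + by left.
- by case=> k' Ck' /val_inj <-.
- by right; exists k.
Qed.

Lemma restrK x y : linked x y -> glue x (restr y) = y.
Proof.
move=> xy; have xi : mc_set x.2 i by case: xy.
apply: restr_inj; last by rewrite glueK.
by apply: linked_trans xy; apply: linked_sym; exact: linked_glue.
Qed.

Lemma glue_linked x y u : linked x y -> glue x u = glue y u.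
Proof.
move=> xy; have [xi yi _ _] := xy; apply: restr_inj; last by rewrite !glueK.
apply: linked_trans (linked_sym (linked_glue u xi)) _.
exact: linked_trans xy (linked_glue u yi).
Qed.

End Restriction.

Section Psi.
Variables (K : fieldType) (aleph : pointedType).
Variables (d : Order.disp_t) (P : porderType d).
Local Notation Q := (cfm K (X aleph P)).

Section PsiAt.
Variable i : P.

Fact psi_colfin (a : cfm K (X aleph (up i))) y : finite_set
  [set x | (if `[< linked i x y >] then a (restr i x) (restr i y) else 0) != 0].
Proof.
apply: (@sub_finite_set _ _ (glue y @` [set u | a u (restr i y) != 0])).
  move=> x /=; case: asboolP => [xy axy|_]; last by rewrite eqxx.
  by exists (restr i x) => //; apply: restrK; exact: linked_sym.
by apply: finite_image; exact: cfm_colfin.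
Qed.

Definition psi (a : cfm K (X aleph (up i))) : Q := CFM (psi_colfin a).

Lemma psiE a x y : psi a x y =
  if `[< linked i x y >] then a (restr i x) (restr i y) else 0.
Proof. by []. Qed.

Lemma psi0 : psi 0 = 0.
Proof. by apply: cfmP => x y; rewrite psiE; case: ifP. Qed.

Lemma psiD a b : psi (a + b) = psi a + psi b.
Proof.
by apply: cfmP => x y; rewrite cfmDE !psiE; case: ifP => //; rewrite addr0.
Qed.

Lemma psiZ c a : psi (c *: a) = c *: psi a.
Proof.
by apply: cfmP => x y; rewrite cfmZE !psiE; case: ifP => //; rewrite mulr0.
Qed.

(* A matrix preserving the classes of [linked i] and acting in the same way
   on all of them. *)
Definition compatible (N : Q) :=
  [/\ forall x y : X aleph P, mc_set x.2 i -> N x y != 0 -> linked i x y,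
      forall x y : X aleph P, mc_set x.2 i -> N y x != 0 -> linked i x y &
      forall (x y : X aleph P) (u v : X aleph (up i)),
        mc_set x.2 i -> mc_set y.2 i ->
        N (glue x u) (glue x v) = N (glue y u) (glue y v)].

Lemma base_ex : exists x : X aleph P, mc_set x.2 i.
Proof.
have [|A mA iA] := @ex_maxchain _ P [set i]; first by move=> x y -> ->; left.
by exists (point, MaxChain mA); exact: iA.
Qed.

Let base := projT1 (cid base_ex).
Let base_i : mc_set base.2 i. Proof. exact: projT2 (cid base_ex). Qed.

Fact local_colfin (N : Q) (v : X aleph (up i)) :
  finite_set [set u : X aleph (up i) | N (glue base u) (glue base v) != 0].
Proof.
apply: (@finite_preimage _ _ [set x | N x (glue base v) != 0]
  (glue base : X aleph (up i) -> _)); last exact: cfm_colfin.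
by move=> u w _ _ /(congr1 (restr i)); rewrite !glueK.
Qed.

Definition local (N : Q) : cfm K (X aleph (up i)) := CFM (local_colfin N).

Lemma compatible_psi a : compatible (psi a).
Proof.
split=> [x y _|x y _|x y u v xi yi]; rewrite ?psiE.
- by case: asboolP => //; rewrite eqxx.
- by case: asboolP => [/linked_sym//|]; rewrite eqxx.
- rewrite !glueK// !asboolT//.
    by apply: linked_trans (linked_sym _) (linked_glue _ yi); exact: linked_glue.
  by apply: linked_trans (linked_sym _) (linked_glue _ xi); exact: linked_glue.
Qed.

Lemma localE (N : Q) x u v : compatible N -> mc_set x.2 i ->
  local N u v = N (glue x u) (glue x v).
Proof. by case=> _ _ N3 xi; exact: N3. Qed.

Lemma psi_local a (N : Q) : compatible N ->
  psi a * N = psi (a * local N).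
Proof.
move=> cN; have [N1 N2 _] := cN; apply: cfmP => x y; rewrite psiE !cfmME.
have [xy|nxy] := asboolP (linked i x y); last first.
  apply: fsbig1 => z _; rewrite psiE; case: asboolP => [xz|]; rewrite ?mul0r//.
  have [->|Nzy] := eqVneq (N z y) 0; first by rewrite mulr0.
  case: nxy; apply: (linked_trans xz); apply: N1 Nzy.
  by have [] := linked_sym xz.
have xi : mc_set x.2 i by case: xy.
transitivity (\sum_(z \in glue x @` [set: X aleph (up i)]) psi a x z * N z y).
  apply/esym/fsbig_widen => // z [_ nz] /=.
  case: asboolP => [xz|]; rewrite ?mul0r//; case: nz.
  by exists (restr i z) => //; exact: restrK.
rewrite fsbig_image; last first.
  by move=> u v _ _ /(congr1 (restr i)); rewrite !glueK.
apply: eq_fsbigr => u _; rewrite psiE asboolT; last exact: linked_glue.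
by rewrite glueK// (localE _ _ cN xi) restrK.
Qed.

Lemma local_psi a (N : Q) : compatible N ->
  N * psi a = psi (local N * a).
Proof.
move=> cN; have [N1 N2 _] := cN; apply: cfmP => x y; rewrite psiE !cfmME.
have [xy|nxy] := asboolP (linked i x y); last first.
  apply: fsbig1 => z _; rewrite psiE; case: asboolP => [zy|]; rewrite ?mulr0//.
  have [->|Nxz] := eqVneq (N x z) 0; first by rewrite mul0r.
  case: nxy; apply: (linked_trans _ zy); apply: linked_sym; apply: N2 Nxz.
  by have [] := zy.
have xi : mc_set x.2 i by case: xy.
transitivity (\sum_(z \in glue x @` [set: X aleph (up i)]) N x z * psi a z y).
  apply/esym/fsbig_widen => // z [_ nz] /=.
  case: asboolP => [zy|]; rewrite ?mulr0//; case: nz.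
  exists (restr i z) => //; apply: restrK.
  by apply: linked_trans xy _; exact: linked_sym.
rewrite fsbig_image; last first.
  by move=> u v _ _ /(congr1 (restr i)); rewrite !glueK.
apply: eq_fsbigr => u _; rewrite psiE asboolT; last first.
  by apply: linked_trans (linked_sym _) xy; exact: linked_glue.
by rewrite glueK// (localE _ _ cN xi) restrK//; exact: linked_refl xy.
Qed.

Lemma local_psi1 : local (psi 1) = 1.
Proof.
apply: cfmP => u v; rewrite (localE u v (compatible_psi 1) base_i) psiE.
rewrite !glueK// asboolT//.
by apply: linked_trans (linked_sym _) (linked_glue _ _) => //; exact: linked_glue.
Qed.

End PsiAt.

Arguments psi : clear implicits.

Section Comparable.
Variables (i j : P).
Hypothesis ij : (i <= j)%O.

Lemma linked_le (x y : X aleph P) : mc_set x.2 i ->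
  linked j x y -> linked i x y.
Proof.
move=> xi [xj yj AB pq].
have AB' k : (k <= j)%O -> mc_set x.2 k = mc_set y.2 k.
  move=> kj; apply/propext; split=> h.
    by have [] : (mc_set y.2 `&` [set k | k <= j]%O) k by rewrite -AB.
  by have [] : (mc_set x.2 `&` [set k | k <= j]%O) k by rewrite AB.
split=> //; first by rewrite -AB'.
  apply/seteqP; split=> k [kA /= ki]; split=> //.
    by rewrite -AB'//; exact: le_trans ij.
  by rewrite AB'//; exact: le_trans ij.
by move=> k ik; apply: pq; apply: contra ik; exact: le_trans.
Qed.

Lemma glue_fun_up (x : X aleph P) (u : X aleph (up i)) k (ik : (i <= k)%O) :
  (glue x u).1 k = u.1 (exist _ k ik).
Proof. by rewrite /= insubT. Qed.

Lemma glue_chain_up (x : X aleph P) (u : X aleph (up i)) k (ik : (i <= k)%O) :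
  mc_set x.2 i -> mc_set (glue x u).2 k = mc_set u.2 (exist _ k ik).
Proof.
move=> xi; rewrite -[in RHS](glueK u xi) /= restr_chainE//.
by have [_ ?] := linked_glue u xi.
Qed.

Lemma glue_chain_out (x : X aleph P) (u : X aleph (up i)) k :
  mc_set x.2 i -> ~~ (i <= k)%O ->
  mc_set (glue x u).2 k = (mc_set x.2 k /\ (k <= i)%O).
Proof.
move=> xi ik; rewrite /= glue_chainE//; apply/propext; split; last by left.
by case=> // -[k' _ kk']; case/negP: ik; rewrite -kk' (valP k').
Qed.

Lemma linked_glue_le (x y : X aleph P) (u v : X aleph (up i)) :
  mc_set x.2 i -> mc_set y.2 i ->
  linked j (glue x u) (glue x v) -> linked j (glue y u) (glue y v).
Proof.
move=> xi yi [uj vj AB pq]; split.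
- by move: uj; rewrite !glue_chain_up.
- by move: vj; rewrite !glue_chain_up.
- apply/seteqP; split=> k [kA kj]; split=> //; move: kA.
    have [ik|ik] := boolP (i <= k)%O; last by rewrite !glue_chain_out.
    rewrite !glue_chain_up// -(glue_chain_up u ik xi) -(glue_chain_up v ik xi).
    move=> h; suff [] : (mc_set (glue x v).2 `&` [set k | k <= j]%O) k by [].
    by rewrite -AB.
  have [ik|ik] := boolP (i <= k)%O; last by rewrite !glue_chain_out.
  rewrite !glue_chain_up// -(glue_chain_up u ik xi) -(glue_chain_up v ik xi).
  move=> h; suff [] : (mc_set (glue x u).2 `&` [set k | k <= j]%O) k by [].
  by rewrite AB.
- move=> k jk; have := pq k jk; have [ik|ik] := boolP (i <= k)%O.
    by rewrite !(glue_fun_up _ _ ik).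
  by rewrite /= insubN.
Qed.

Lemma restr_glue_le (x y : X aleph P) (u : X aleph (up i)) :
  mc_set x.2 i -> mc_set y.2 i -> mc_set (glue x u).2 j ->
  restr j (glue x u) = restr j (glue y u).
Proof.
move=> xi yi uj; congr pair.
  apply: alephfunP => -[k jk].
  change ((glue x u).1 k = (glue y u).1 k).
  by rewrite !(glue_fun_up _ _ (le_trans ij jk)).
apply: maxchainP; rewrite !restr_chainE//; last first.
  by move: uj; rewrite !glue_chain_up.
apply/funext => -[k jk].
change (mc_set (glue x u).2 k = mc_set (glue y u).2 k).
by rewrite !(glue_chain_up _ (le_trans ij jk)).
Qed.

Lemma compatible_le b : compatible i (psi j b).
Proof.
split=> [x y xi|x y xi|x y u v xi yi]; rewrite ?psiE.
- by case: asboolP => [xy _|]; [exact: linked_le|rewrite eqxx].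
- case: asboolP => [yx _|]; last by rewrite eqxx.
  by apply: linked_le => //; exact: linked_sym.
- case: asboolP => xl; case: asboolP => yl //.
  + by have [? ? _ _] := xl; rewrite !(restr_glue_le xi yi).
  + by case: yl; exact: linked_glue_le xl.
  + by case: xl; exact: linked_glue_le yl.
Qed.

End Comparable.

Lemma psi_incomparable i j (a : cfm K (X aleph (up i)))
    (b : cfm K (X aleph (up j))) :
  ~~ (i <= j)%O -> ~~ (j <= i)%O -> psi i a * psi j b = 0.
Proof.
move=> ij ji; apply: cfmP => x y; rewrite cfmME; apply: fsbig1 => z _.
rewrite !psiE; case: asboolP => [xz|]; rewrite ?mul0r//.
case: asboolP => [zy|]; rewrite ?mulr0//.
have [_ zi _ _] := xz; have [zj _ _ _] := zy.
by have [h|h] := mc_tot zi zj; [case/negP: ij|case/negP: ji].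
Qed.

End Psi.

Arguments psi {K aleph d P} i a.

(* Subalgebras need not contain 1, and ideals are two-sided and [K]-stable. *)
Record subalg (K : fieldType) (Q : algType K) := Subalg {
  subalg_set :> set Q;
  subalg0 : subalg_set 0;
  subalgD : forall x y, subalg_set x -> subalg_set y -> subalg_set (x + y);
  subalgZ : forall c x, subalg_set x -> subalg_set (c *: x);
  subalgM : forall x y, subalg_set x -> subalg_set y -> subalg_set (x * y) }.

Section Ideals.
Variables (K : fieldType) (Q : algType K) (S : subalg Q).

Record ideal := Ideal {
  ideal_set :> set Q;
  ideal_sub : ideal_set `<=` S;
  ideal0 : ideal_set 0;
  idealD : forall x y, ideal_set x -> ideal_set y -> ideal_set (x + y);
  idealZ : forall c x, ideal_set x -> ideal_set (c *: x);
  idealMl : forall a x, subalg_set S a -> ideal_set x -> ideal_set (a * x);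
  idealMr : forall a x, subalg_set S a -> ideal_set x -> ideal_set (x * a) }.

HB.instance Definition _ := gen_eqMixin ideal.
HB.instance Definition _ := gen_choiceMixin ideal.

Lemma idealP (M N : ideal) : M = N :> set Q -> M = N.
Proof.
case: M N => [M ? ? ? ? ? ?] [N ? ? ? ? ? ?] /= MN; subst N.
by congr Ideal; exact: Prop_irrelevance.
Qed.

Fact ideal_display : Order.disp_t. Proof. exact: Order.Disp tt tt. Qed.

Definition ideal_le (M N : ideal) := `[< M `<=` N >].

Fact ideal_le_refl : reflexive ideal_le.
Proof. by move=> M; apply/asboolP. Qed.
Fact ideal_le_anti : antisymmetric ideal_le.
Proof.
by move=> M N /andP[/asboolP MN /asboolP NM]; apply/idealP/seteqP.
Qed.
Fact ideal_le_trans : transitive ideal_le.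
Proof.
move=> N M L /asboolP MN /asboolP NL; apply/asboolP; exact: subset_trans NL.
Qed.

HB.instance Definition _ := Order.Le_isPOrder.Build ideal_display ideal
  ideal_le_refl ideal_le_anti ideal_le_trans.

Lemma le_idealE (M N : ideal) : (M <= N)%O = `[< M `<=` N >].
Proof. by []. Qed.

Definition ideal_meet (M N : ideal) : ideal.
Proof.
refine (@Ideal (M `&` N) _ _ _ _ _ _).
- by move=> x [/ideal_sub].
- by split; exact: ideal0.
- by move=> x y [? ?] [? ?]; split; exact: idealD.
- by move=> c x [? ?]; split; exact: idealZ.
- by move=> a x ? [? ?]; split; exact: idealMl.
- by move=> a x ? [? ?]; split; exact: idealMr.
Defined.

Definition ideal_join (M N : ideal) : ideal.
Proof.
refine (@Ideal [set z | exists2 x, ideal_set M x &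
                        exists2 y, ideal_set N y & z = x + y] _ _ _ _ _ _).
- move=> _ [x Mx [y Ny ->]].
  by apply: subalgD; [exact: ideal_sub Mx|exact: ideal_sub Ny].
- by exists 0; [exact: ideal0|exists 0; [exact: ideal0|rewrite addr0]].
- move=> _ _ [x Mx [y Ny ->]] [x' Mx' [y' Ny' ->]].
  exists (x + x'); first exact: idealD.
  by exists (y + y'); [exact: idealD|rewrite addrACA].
- move=> c _ [x Mx [y Ny ->]]; exists (c *: x); first exact: idealZ.
  by exists (c *: y); [exact: idealZ|rewrite scalerDr].
- move=> a _ Sa [x Mx [y Ny ->]]; exists (a * x); first exact: idealMl.
  by exists (a * y); [exact: idealMl|rewrite mulrDr].
- move=> a _ Sa [x Mx [y Ny ->]]; exists (x * a); first exact: idealMr.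
  by exists (y * a); [exact: idealMr|rewrite mulrDl].
Defined.

Fact ideal_meetP (L M N : ideal) :
  (L <= ideal_meet M N)%O = (L <= M)%O && (L <= N)%O.
Proof.
rewrite !le_idealE; apply/asboolP/andP => [h|[/asboolP LM /asboolP LN]].
  by split; apply/asboolP => x /h [].
by move=> x Lx; split; [exact: LM|exact: LN].
Qed.

Fact ideal_joinP (L M N : ideal) :
  (ideal_join L M <= N)%O = (L <= N)%O && (M <= N)%O.
Proof.
rewrite !le_idealE; apply/asboolP/andP => [h|[/asboolP LN /asboolP MN]].
  split; apply/asboolP => x Hx; apply: h.
    by exists x => //; exists 0; [exact: ideal0|rewrite addr0].
  by exists 0; [exact: ideal0|exists x; rewrite ?add0r].
by move=> _ [x Lx [y My ->]]; apply: idealD; [exact: LN|exact: MN].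
Qed.

HB.instance Definition _ := Order.POrder_MeetJoin_isLattice.Build
  ideal_display ideal ideal_meetP ideal_joinP.

End Ideals.

Section LowerSubsets.
Variables (d : Order.disp_t) (P : porderType d) (J : set P).

Record lowerset := Lowerset {
  lower_set :> set P;
  lower_sub : lower_set `<=` J;
  lower_closed : forall j l, J j -> lower_set l -> (j <= l)%O -> lower_set j }.

HB.instance Definition _ := gen_eqMixin lowerset.
HB.instance Definition _ := gen_choiceMixin lowerset.

Lemma lowersetP (L M : lowerset) : L = M :> set P -> L = M.
Proof.
case: L M => [L ? ?] [M ? ?] /= LM; subst M.
by congr Lowerset; exact: Prop_irrelevance.
Qed.

Fact lowerset_display : Order.disp_t. Proof. exact: Order.Disp tt tt. Qed.

Definition lowerset_le (L M : lowerset) := `[< L `<=` M >].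

Fact lowerset_le_refl : reflexive lowerset_le.
Proof. by move=> M; apply/asboolP. Qed.
Fact lowerset_le_anti : antisymmetric lowerset_le.
Proof.
by move=> M N /andP[/asboolP MN /asboolP NM]; apply/lowersetP/seteqP.
Qed.
Fact lowerset_le_trans : transitive lowerset_le.
Proof.
move=> N M L /asboolP MN /asboolP NL; apply/asboolP; exact: subset_trans NL.
Qed.

HB.instance Definition _ := Order.Le_isPOrder.Build lowerset_display lowerset
  lowerset_le_refl lowerset_le_anti lowerset_le_trans.

Lemma le_lowersetE (L M : lowerset) : (L <= M)%O = `[< L `<=` M >].
Proof. by []. Qed.

Definition lowerset_meet (L M : lowerset) : lowerset.
Proof.
refine (@Lowerset (L `&` M) _ _); first by move=> x [/lower_sub].
by move=> j l Jj [? ?] jl; split; apply: lower_closed jl.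
Defined.

Definition lowerset_join (L M : lowerset) : lowerset.
Proof.
refine (@Lowerset (L `|` M) _ _); first by move=> x [/lower_sub|/lower_sub].
by move=> j l Jj [?|?] jl; [left|right]; apply: lower_closed jl.
Defined.

Fact lowerset_meetP (L M N : lowerset) :
  (L <= lowerset_meet M N)%O = (L <= M)%O && (L <= N)%O.
Proof.
rewrite !le_lowersetE; apply/asboolP/andP => [h|[/asboolP LM /asboolP LN]].
  by split; apply/asboolP => x /h [].
by move=> x Lx; split; [exact: LM|exact: LN].
Qed.

Fact lowerset_joinP (L M N : lowerset) :
  (lowerset_join L M <= N)%O = (L <= N)%O && (M <= N)%O.
Proof.
rewrite !le_lowersetE; apply/asboolP/andP => [h|[/asboolP LN /asboolP MN]].
  by split; apply/asboolP => x Hx; apply: h; [left|right].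
by move=> x [Lx|Mx]; [exact: LN|exact: MN].
Qed.

HB.instance Definition _ := Order.POrder_MeetJoin_isLattice.Build
  lowerset_display lowerset lowerset_meetP lowerset_joinP.

End LowerSubsets.

Section IdealsOfPoset.
Variables (K : fieldType) (aleph : pointedType).
Variables (d : Order.disp_t) (I : porderType d).
Local Notation Q := (cfm K (X aleph I)).

Definition maximal_elt (i : I) := forall k : I, (i <= k)%O -> k = i.

Definition H_at (i : I) : set Q :=
  if `[< maximal_elt i >] then [set c *: psi i 1 | c in [set: K]]
  else psi i @` @FR K (X aleph (up i)).

Lemma H_at0 i : H_at i 0.
Proof.
rewrite /H_at; case: asboolP => _; first by exists 0; rewrite ?scale0r.
by exists 0; [exact: FR0|rewrite psi0].
Qed.

Lemma H_atD i x y : H_at i x -> H_at i y -> H_at i (x + y).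
Proof.
rewrite /H_at; case: asboolP => _ [a fa <-] [b fb <-].
  by exists (a + b); rewrite ?scalerDl.
by exists (a + b); [exact: FRD|rewrite psiD].
Qed.

Lemma H_atZ i c x : H_at i x -> H_at i (c *: x).
Proof.
rewrite /H_at; case: asboolP => _ [a fa <-].
  by exists (c * a); rewrite ?scalerA.
by exists (c *: a); [exact: FRZ|rewrite psiZ].
Qed.

Lemma H_at_psi i x : H_at i x -> exists a, x = psi i a.
Proof.
rewrite /H_at; case: asboolP => _ [a _ <-]; last by exists a.
by exists (a *: 1); rewrite psiZ.
Qed.

Lemma H_atM i j x y : H_at i x -> H_at j y -> H_at i (x * y) \/ H_at j (x * y).
Proof.
move=> Hx Hy; have [ax ex] := H_at_psi Hx; have [ay ey] := H_at_psi Hy.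
have [ij|nij] := boolP (i <= j)%O.
  left; have cy : compatible i y by rewrite ey; exact: compatible_le.
  have [mi|nmi] := pselect (maximal_elt i).
    have ji := mi _ ij; subst j; move: Hx Hy.
    rewrite /H_at asboolT// => -[a _ <-] [b _ <-]; exists (a * b) => //.
    rewrite -scalerAl -scalerAr scalerA; congr (_ *: _).
    by rewrite psi_local ?local_psi1 ?mulr1//; exact: compatible_psi.
  move: Hx; rewrite /H_at asboolF// => -[a fa <-].
  by exists (a * local i y); [exact: FRMr|rewrite psi_local].
have [ji|nji] := boolP (j <= i)%O; last first.
  by left; rewrite ex ey psi_incomparable//; exact: H_at0.
right; have cx : compatible j x by rewrite ex; exact: compatible_le.
have nmj : ~ maximal_elt j by move=> /(_ _ ji) ij; rewrite ij lexx in nij.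
move: Hy; rewrite /H_at asboolF// => -[a fa <-].
by exists (local j x * a); [exact: FRMl|rewrite local_psi].
Qed.

Section SumOver.
Variable J : set I.

Definition H_set : set Q :=
  [set x | exists f : I -> Q,
    [/\ forall j, H_at j (f j), finite_set [set j | f j != 0] &
        x = \sum_(j \in J) f j]].

Lemma H_set_at j x : J j -> H_at j x -> H_set x.
Proof.
move=> Jj Hx; exists (fun k => if k == j then x else 0); split.
- by move=> k; case: eqP => [->//|_]; exact: H_at0.
- apply: (sub_finite_set _ (finite_set1 j)) => k /=.
  by have [->//|_] := eqVneq k j; rewrite eqxx.
- rewrite -(@fsbig_widen _ _ _ _ [set j])//= ?fsbig_set1 ?eqxx//.
    by move=> k ->.
  by move=> k [_ /= /eqP /negbTE->].
Qed.

Lemma H_set_sumE (f : I -> Q) (D : set I) : [set j | f j != 0] `<=` D ->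
  \sum_(j \in J) f j = \sum_(j \in J `&` D) f j.
Proof.
move=> fD; apply/esym/fsbig_widen; first by move=> k [].
move=> k [Jk nk] /=; apply/eqP; apply: contrapT => /negP fk.
by apply: nk; split=> //; exact: fD.
Qed.

Lemma H_set0 : H_set 0.
Proof.
exists (fun=> 0); split; first by move=> j; exact: H_at0.
  by apply: (sub_finite_set _ (@finite_set0 I)) => k /=; rewrite eqxx.
by rewrite fsbig1.
Qed.

Lemma H_setD x y : H_set x -> H_set y -> H_set (x + y).
Proof.
move=> [f [Hf ff ->]] [g [Hg fg ->]].
pose D := [set j | f j != 0] `|` [set j | g j != 0].
have fD : finite_set D by rewrite finite_setU.
have sD : [set j | f j + g j != 0] `<=` D.
  move=> k /=; have [->|] := eqVneq (f k) 0; last by left.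
  by rewrite add0r; right.
exists (fun j => f j + g j); split.
- by move=> j; exact: H_atD.
- exact: sub_finite_set fD.
- rewrite (H_set_sumE sD) (@H_set_sumE f D); last by move=> k; left.
  rewrite (@H_set_sumE g D); last by move=> k; right.
  by rewrite fsbig_split//; exact: finite_setIr.
Qed.

Lemma H_set_ind (p : Q -> Prop) : p 0 ->
  (forall x y, p x -> p y -> p (x + y)) ->
  (forall j x, J j -> H_at j x -> p x) ->
  forall x, H_set x -> p x.
Proof.
move=> p0 pD pH _ [f [Hf ff ->]].
rewrite (@H_set_sumE f [set j | f j != 0])// fsbig_finite; last first.
  exact: finite_setIr.
rewrite big_seq; apply: big_ind => // j; rewrite in_fset_set; last first.
  exact: finite_setIr.
by move=> /set_mem[Jj _]; exact: (pH j).
Qed.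

Lemma H_setZ c x : H_set x -> H_set (c *: x).
Proof.
apply: (@H_set_ind (fun x => H_set (c *: x))).
- by rewrite scaler0; exact: H_set0.
- by move=> a b; rewrite scalerDr; exact: H_setD.
- by move=> j a Jj Ha; apply: (H_set_at Jj); exact: H_atZ.
Qed.

Lemma H_setM x y : H_set x -> H_set y -> H_set (x * y).
Proof.
move=> Hx Hy; move: x Hx; apply: H_set_ind.
- by rewrite mul0r; exact: H_set0.
- by move=> a b; rewrite mulrDl; exact: H_setD.
move=> i a Ji Ha; move: y Hy; apply: H_set_ind.
- by rewrite mulr0; exact: H_set0.
- by move=> b c; rewrite mulrDr; exact: H_setD.
by move=> j b Jj Hb; have [] := H_atM Ha Hb; exact: H_set_at.
Qed.

Definition H : subalg Q := Subalg H_set0 H_setD H_setZ H_setM.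

End SumOver.

Definition frakB : subalg Q := H [set: I].

End IdealsOfPoset.

Definition aleph_poset (aleph : pointedType) d (I : porderType d) : Prop :=
  ([set: I] #<= [set: aleph])%card /\ (@maxchains d I #<= [set: aleph])%card.

Definition has_finite_cofinal_subset d (I : porderType d) : Prop :=
  exists2 F : set I, finite_set F &
    forall i : I, exists2 k : I, F k & (i <= k)%O.

(* Main.v *)
(* Let x be an element of an ideal M, with finitely many components x_j, and
   let i be minimal in the support of x.  Then x preserves the blocks of psi_i,
   so that psi_i(e_uu) x psi_i(e_vv) is a multiple of psi_i(e_uv), with
   coefficient an entry of x on a block.  If i is not maximal, some such entry
   is nonzero, so M contains H(I, i) because FR is simple; if i is maximal,
   x psi_i(1) = x_i.  Subtracting x_i and iterating, M contains H(I, j) for each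
   j in the support.  Applied to an element of H(I, l) and j < l, the same
   computation shows that {j in J : H(I, j) <= M} is a lower subset.  The
   nonvanishing of entries also gives the directness of the sum of the H(I, j),
   hence the injectivity of L |-> H(I, L). *)

Require Import Defs.
From HB Require Import structures.
From mathcomp Require Import all_boot all_order all_algebra.
From mathcomp Require Import all_classical.

Local Open Scope classical_set_scope.
Local Open Scope ring_scope.

Set Implicit Arguments.
Unset Strict Implicit.
Import Order.TTheory GRing.Theory.

(** * Extremal elements of finite lists, lattice isomorphisms, finite sets *)

Lemma ex_maximal_ge d (T : porderType d) (s : seq T) (i : T) :
  exists m, [/\ m \in i :: s, (i <= m)%O & forall k, k \in s -> ~~ (m < k)%O].
Proof.
elim: s i => [|x s IHs] i; first by exists i; rewrite inE.
(* When [i < x] the lower bound moves up to [x]; otherwise no [m] with [i <= m] can be strictly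
   below [x]. *)
have [ix|nix] := boolP (i < x)%O.
  have [m [ms xm mm]] := IHs x.
  exists m; split; first by rewrite inE ms orbT.
    exact: le_trans (ltW ix) xm.
  by move=> k; rewrite inE => /predU1P[->|/mm//]; rewrite (le_gtF xm).
have [m [ms im mm]] := IHs i.
exists m; split=> //.
  by move: ms; rewrite !inE => /orP[]->//; rewrite !orbT.
move=> k; rewrite inE => /predU1P[->|/mm//].
by apply: contra nix; exact: le_lt_trans.
Qed.

Lemma ex_minimal d (T : porderType d) (s : seq T) : s != [::] ->
  exists2 m, m \in s & forall k, k \in s -> ~~ (k < m)%O.
Proof.
case: s => // x s _; have [m [ms xm mm]] := @ex_maximal_ge _ T^d s x.
exists m => // k; rewrite inE => /predU1P[->|/mm//].
by apply/negP => xm'; move: (lt_le_trans xm' xm); rewrite ltxx.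
Qed.

(** Lower and upper bounds in [T'] transport back along [g], which is monotone too, so meets and
    joins are preserved. *)
Lemma order_iso_lmorphism d d' (T : latticeType d) (T' : latticeType d')
    (f : T -> T') (g : T' -> T) :
  cancel f g -> cancel g f -> {mono f : x y / (x <= y)%O} ->
  exists phi : {lmorphism T -> T'}, phi = f :> (T -> T').
Proof.
move=> fK gK fmono.
have gmono : {mono g : x y / (x <= y)%O} by move=> x y; rewrite -fmono !gK.
have fI : Order.meet_morphism f.
  move=> x y; apply/eqP; rewrite eq_le lexI !fmono leIl leIr /=.
  by rewrite -gmono fK lexI -2!fmono gK leIl leIr.
have fU : Order.join_morphism f.
  move=> x y; apply/eqP; rewrite eq_le leUx !fmono leUl leUr /= andbT.
  by rewrite -gmono fK leUx -2!fmono gK leUl leUr.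
have fle : {homo f : x y / (x <= y)%O} by move=> x y; rewrite fmono.
pose m1 := Order.isOrderMorphism.Build d T d' T' f fle.
pose m2 := Order.isMeetLatticeMorphism.Build d T d' T' f fI.
pose m3 := Order.isJoinLatticeMorphism.Build d T d' T' f fU.
pose phi : {lmorphism T -> T'} := HB.pack f m1 m2 m3.
by exists phi.
Qed.

Lemma finite_uniq_seq (T : choiceType) (A : set T) : finite_set A ->
  exists2 s : seq T, uniq s & A = [set` s].
Proof.
move=> /finite_seqP[s ->]; exists (undup s); first exact: undup_uniq.
by apply/seteqP; split=> x /=; rewrite mem_undup.
Qed.

(** * Matrix units among column-finite matrices *)

Section MatrixUnits.
Variables (K : fieldType) (T : pointedType).
Implicit Types (a : cfm K T) (x y u v : T).

Fact munit_colfin u v y :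
  finite_set [set x | ((x == u) && (y == v))%:R != 0 :> K].
Proof.
apply: (sub_finite_set _ (finite_set1 u)) => x /=.
by case: (eqVneq x u) => //=; rewrite eqxx.
Qed.
Definition munit u v : cfm K T := CFM (munit_colfin u v).

Lemma munitE u v x y : munit u v x y = ((x == u) && (y == v))%:R.
Proof. by []. Qed.

Lemma munit_mull u v a x y : (munit u v * a) x y = (x == u)%:R * a v y.
Proof.
rewrite cfmME -(@fsbig_widen _ _ _ _ [set v])//= ?fsbig_set1.
  by rewrite eqxx andbT.
by move=> z [_ /= /eqP/negbTE ->]; rewrite andbF mul0r.
Qed.

Lemma munit_mulr u v a x y : (a * munit u v) x y = a x u * (y == v)%:R.
Proof.
rewrite cfmME -(@fsbig_widen _ _ _ _ [set u])//= ?fsbig_set1.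
  by rewrite eqxx.
by move=> z [_ /= /eqP/negbTE ->]; rewrite mulr0.
Qed.

Lemma munit_sandwich u v a : munit u u * a * munit v v = a u v *: munit u v.
Proof.
apply: cfmP => x y; rewrite munit_mulr munit_mull cfmZE munitE.
by rewrite -mulnb natrM mulrCA mulrA.
Qed.

Lemma munitM u v w : munit u v * munit v w = munit u w.
Proof.
by apply: cfmP => x y; rewrite munit_mull !munitE eqxx /= -natrM mulnb.
Qed.

Lemma FR_munit u v : FR (munit u v).
Proof.
apply: (sub_finite_set _ (finite_set1 u)) => x [y] /=.
by case: (eqVneq x u) => //=; rewrite eqxx.
Qed.

Lemma cfm_sumE (J : Type) (s : seq J) (f : J -> cfm K T) x y :
  (\sum_(j <- s) f j) x y = \sum_(j <- s) f j x y.
Proof. by elim: s => [|j s IHs]; rewrite ?big_nil// !big_cons cfmDE IHs. Qed.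

(** With [s] the list of nonzero rows of [a], the sum of the [munit w w] is a left identity for [a].
    These rows may have infinite support, so [a] itself need not be a finite combination of matrix
    units. *)
Lemma FR_sum_munit a : FR a ->
  exists s : seq T, a = \sum_(w <- s) munit w w * a.
Proof.
move=> /finite_uniq_seq[s us es]; exists s.
apply: cfmP => x y; rewrite cfm_sumE.
under eq_bigr => w _ do rewrite munit_mull.
have [sx|nsx] := boolP (x \in s).
  rewrite (bigD1_seq x)//= eqxx mul1r big1 ?addr0// => w /negbTE.
  by rewrite eq_sym => ->; rewrite mul0r.
rewrite big_seq big1 => [|w sw].
  apply/eqP; apply: contraNT nsx => axy.
  by have : [set` s] x by rewrite -es; exists y.
by case: eqP => [xw|]; rewrite ?mul0r//; rewrite -xw (negbTE nsx) in sw.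
Qed.

End MatrixUnits.

(** * Compatibility with blocks, and products of components *)

Section Components.
Variables (K : fieldType) (aleph : pointedType).
Variables (d : Order.disp_t) (I : porderType d).
Local Notation Q := (cfm K (X aleph I)).
Implicit Types (i j k l m : I) (x y : X aleph I) (z : Q).

Lemma compatibleD i z w : compatible i z -> compatible i w ->
  compatible i (z + w).
Proof.
move=> [z1 z2 z3] [w1 w2 w3]; split=> [x y xi|x y xi|x y u v xi yi].
- rewrite cfmDE; have [->|zxy _] := eqVneq (z x y) 0; last exact: z1.
  by rewrite add0r; exact: w1.
- rewrite cfmDE; have [->|zxy _] := eqVneq (z y x) 0; last exact: z2.
  by rewrite add0r; exact: w2.
- by rewrite !cfmDE (z3 _ _ _ _ xi yi) (w3 _ _ _ _ xi yi).
Qed.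

Lemma compatible0 i : compatible i (0 : Q).
Proof. by split=> [x y _|x y _|x y u v _ _]; rewrite ?cfm0E ?eqxx. Qed.

Lemma compatible_sum i (s : seq I) (f : I -> Q) :
  (forall k, k \in s -> compatible i (f k)) ->
  compatible i (\sum_(k <- s) f k).
Proof.
move=> cf; rewrite big_seq; apply: big_ind => //; first exact: compatible0.
exact: compatibleD.
Qed.

Lemma psi_entry_comparable i j (b : cfm K (X aleph (up j))) x y :
  mc_set x.2 i -> psi j b x y != 0 -> (i <= j)%O \/ (j <= i)%O.
Proof.
move=> xi; rewrite psiE; case: asboolP => [[xj _ _ _] _|]; last by rewrite eqxx.
exact: mc_tot xi xj.
Qed.

(** Serves to exploit minimality of [i] in a support. If [i] and [j] are incomparable, no chain
    contains both, so the entries of [psi j b] in rows and columns through [i] all vanish. *)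
Lemma compatible_psi_nlt i j (b : cfm K (X aleph (up j))) :
  ~~ (j < i)%O -> compatible i (psi j b).
Proof.
move=> nji; have [ij|nij] := boolP (i <= j)%O; first exact: compatible_le.
have b0 x y : mc_set x.2 i -> psi j b x y = 0.
  move=> xi; apply/eqP; apply/negP => /negP/(psi_entry_comparable xi).
  rewrite (negbTE nij) => -[//|ji]; move: nji; rewrite lt_neqAle ji andbT.
  by move=> /negPn/eqP eji; rewrite eji lexx in nij.
have b0' x y : mc_set x.2 i -> psi j b y x = 0.
  move=> xi; apply/eqP; apply/negP => /negP h.
  have jx : linked j y x by move: h; rewrite psiE; case: asboolP; rewrite ?eqxx.
  have := h; rewrite psiE asboolT//.
  have [_ xj _ _] := jx; have [//|ji] := mc_tot xi xj.
    by rewrite (negbTE nij).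
  move: nji; rewrite lt_neqAle ji andbT => /negPn/eqP eji.
  by rewrite eji lexx in nij.
split=> [x y xi|x y xi|x y u v xi yi].
- by rewrite b0 ?eqxx.
- by rewrite b0' ?eqxx.
- by rewrite !b0//; [have [] := linked_glue u yi|have [] := linked_glue u xi].
Qed.

Lemma local_psiK i (b : cfm K (X aleph (up i))) : local i (psi i b) = b.
Proof.
have [x xi] := @base_ex aleph _ I i.
apply: cfmP => u v; rewrite (localE _ _ (compatible_psi _) xi) psiE !glueK//.
rewrite asboolT//; apply: linked_trans (linked_sym _) (linked_glue v xi).
exact: linked_glue.
Qed.

Lemma psiM i (a b : cfm K (X aleph (up i))) :
  psi i (a * b) = psi i a * psi i b.
Proof. by rewrite psi_local ?local_psiK//; exact: compatible_psi. Qed.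

(** For [i < j] the index [i] is not maximal, so [H_at i] is the image of [FR], an ideal that
    absorbs [local i w]. *)
Lemma H_at_mul_le i j z w : (i <= j)%O -> H_at i z -> H_at j w ->
  H_at i (z * w) /\ H_at i (w * z).
Proof.
rewrite le_eqVlt => /predU1P[<-|ij] Hz Hw.
  by split; [have [] := H_atM Hz Hw|have [] := H_atM Hw Hz].
have [b ew] := H_at_psi Hw.
have cw : compatible i w by rewrite ew; apply/compatible_le/ltW.
have nmi : ~ maximal_elt i by move=> /(_ _ (ltW ij)) ji; rewrite ji ltxx in ij.
move: Hz; rewrite /H_at asboolF// => -[a fa <-]; split.
  by exists (a * local i w); [exact: FRMr|rewrite psi_local].
by exists (local i w * a); [exact: FRMl|rewrite local_psi].
Qed.

(** Comparable components multiply into the smaller index, which lies in [L]; incomparable ones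
    multiply to zero. *)
Lemma H_setM_lower (J L : set I) a z :
  (forall j l, J j -> L l -> (j <= l)%O -> L j) ->
  H_set J a -> H_set L z -> H_set L (a * z) /\ H_set L (z * a).
Proof.
move=> Llow Ha Hz; move: a Ha; apply: H_set_ind.
- by rewrite mul0r mulr0; split; exact: H_set0.
- by move=> a b [? ?] [? ?]; rewrite mulrDl mulrDr; split; exact: H_setD.
move=> j a Jj Ha; move: z Hz; apply: H_set_ind.
- by rewrite mul0r mulr0; split; exact: H_set0.
- by move=> b c [? ?] [? ?]; rewrite mulrDl mulrDr; split; exact: H_setD.
move=> l b Ll Hb.
have [jl|njl] := boolP (j <= l)%O.
  have [? ?] := H_at_mul_le jl Ha Hb.
  by split; apply: H_set_at (Llow _ _ Jj Ll jl) _.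
have [lj|nlj] := boolP (l <= j)%O.
  by have [? ?] := H_at_mul_le lj Hb Ha; split; exact: H_set_at Ll _.
have [a' ->] := H_at_psi Ha; have [b' ->] := H_at_psi Hb.
by rewrite !psi_incomparable//; split; exact: H_set0.
Qed.

Lemma H_setS (J L : set I) : L `<=` J -> @H_set K aleph _ I L `<=` H_set J.
Proof.
move=> LJ; apply: H_set_ind; first exact: H_set0.
  by move=> z w; exact: H_setD.
by move=> j z /LJ; exact: H_set_at.
Qed.

Lemma H_set_seq (J : set I) z : H_set J z ->
  exists s : seq I, exists f : I -> Q,
    [/\ uniq s, forall k, k \in s -> J k,
        forall k, k \in s -> H_at k (f k) /\ f k != 0 &
        z = \sum_(k <- s) f k].
Proof.
move=> [f [Hf ff ->]]; pose D := J `&` [set j | f j != 0].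
have fD : finite_set D by exact: finite_setIr.
have [s us es] := finite_uniq_seq fD; exists s, f; split=> //.
- by move=> k ks; have [] : D k by rewrite es.
- by move=> k ks; have [] : D k by rewrite es.
- rewrite (@H_set_sumE _ _ _ _ _ f [set j | f j != 0])//.
  by rewrite -/D es -fsbig_seq.
Qed.

Lemma glue_down i x (u : X aleph (up i)) j :
  mc_set x.2 i -> mc_set x.2 j -> (j <= i)%O ->
  mc_set (Defs.glue x u).2 j.
Proof. by move=> xi xj ji; rewrite /= glue_chainE//; left. Qed.

Lemma H_at_nonmaximal i z : ~ maximal_elt i -> H_at i z ->
  exists2 a : cfm K (X aleph (up i)), FR a & z = psi i a.
Proof. by move=> nmi; rewrite /H_at asboolF// => -[a fa <-]; exists a. Qed.

Lemma lt_nonmaximal i j : (i < j)%O -> ~ maximal_elt i.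
Proof. by move=> ij /(_ _ (ltW ij)) ji; rewrite ji ltxx in ij. Qed.

(** * Nonvanishing entries and directness of the sum *)

Hypothesis aleph_infinite : infinite_set [set: aleph].

(** A matrix in [FR] has finitely many nonzero rows, so their values at [i] miss some [t] of the
    infinite [aleph]. *)
Lemma H_at_avoid i z : ~ maximal_elt i -> H_at i z ->
  exists t : aleph, forall x y, x.1 i = t -> z x y = 0.
Proof.
move=> nmi /(H_at_nonmaximal nmi)[a fa ->].
pose W := [set (u : X aleph (up i)).1 (exist _ i (lexx i)) |
           u in [set u | exists v, a u v != 0]].
have fW : finite_set W by exact: finite_image.
have [t [_ nWt]] : ([set: aleph] `\` W) !=set0.
  by apply: infinite_setN0; exact: infinite_setD.
exists t => x y xt; rewrite psiE; case: asboolP => // xy.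
apply/eqP; apply/negP => /negP axy; apply: nWt; exists (restr i x) => //.
by exists (restr i y).
Qed.

(* Rows in the finite supports of the components below [m] are avoided by
   changing the coordinates of both indices below [m]: there are infinitely
   many values to choose from, and the component at [m] does not see them. *)
Lemma sum_entry_neq0 (s : seq I) (f : I -> Q) i : uniq s -> i \in s ->
  (forall k, k \in s -> H_at k (f k) /\ f k != 0) ->
  exists x y, linked i x y /\ (\sum_(k <- s) f k) x y != 0.
Proof.
move=> us si Hf; have [m [ms im mmax]] := ex_maximal_ge s i.
have {}ms : m \in s by move: ms; rewrite inE => /predU1P[->|].
have [Hm fm0] := Hf m ms; have [a em] := H_at_psi Hm.
have [u [v auv]] : exists u v, a u v != 0.
  apply: contrapT => na; case/eqP: fm0; rewrite em.
  suff -> : a = 0 by exact: psi0.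
  apply: cfmP => u v; apply/eqP; apply: contrapT => auv.
  by apply: na; exists u, v; apply/negP.
(* A chain through both [i] and [m] makes indices linked at [m] linked at [i] as well. *)
have [|A mA imA] := @ex_maxchain _ I [set i; m].
  by move=> x y [|] -> [|] ->; rewrite ?lexx ?im; (by left) || by right.
pose tP k t := (k < m)%O -> k \in s -> forall x y, x.1 k = t -> f k x y = 0.
have /choice[t tE] : forall k, exists t : aleph, tP k t.
  move=> k; have [km|nkm] := boolP (k < m)%O; last first.
    by exists point => /(negP nkm).
  have [sk|nsk] := boolP (k \in s); last first.
    by exists point => _ /(negP nsk).
  have [t tE] := H_at_avoid (lt_nonmaximal km) (Hf k sk).1.
  by exists t => _ _; exact: tE.
pose p k := if (k \in s) && (k < m)%O then t k else point.
have pfin : finite_set [set k | p k != point].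
  apply: (@sub_finite_set _ _ [set` s]); last exact: finite_seq.
  by move=> k /=; rewrite /p; case: (k \in s) => //=; rewrite eqxx.
pose b : X aleph I := (AlephFun pfin, MaxChain mA).
have bm : mc_set b.2 m by apply: imA; right.
have bi : mc_set b.2 i by apply: imA; left.
pose x := Defs.glue b u; pose y := Defs.glue b v.
have bu : linked m b x by exact: linked_glue.
have bv : linked m b y by exact: linked_glue.
have xy : linked m x y by exact: linked_trans (linked_sym bu) bv.
have xi : mc_set x.2 i by exact: glue_down.
have xm : mc_set x.2 m by case: xy.
exists x, y; split; first exact: (linked_le im xi).
rewrite cfm_sumE (bigD1_seq m)//= big1_seq ?addr0.
  by rewrite em psiE asboolT// /x /y !glueK.
move=> k /andP[km sk]; have [c ek] := H_at_psi (Hf k sk).1.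
apply/eqP; apply/negP => /negP; rewrite ek => kxy.
have [mk|lekm] := psi_entry_comparable xm kxy.
  by have := mmax _ sk; rewrite lt_neqAle eq_sym km mk.
have ltkm : (k < m)%O by rewrite lt_neqAle km.
move: kxy; rewrite -ek (tE k)// ?eqxx//.
have nmk : ~~ (m <= k)%O by rewrite (lt_geF ltkm).
by case: bu => _ _ _ /(_ k nmk) <-; rewrite /= /p sk ltkm.
Qed.

(** A nonzero witness usable for maximal and non-maximal [i] alike: the identity and the matrix unit
    at [point] both have entry 1 there. *)
Lemma H_at_entry1 i : exists a : cfm K (X aleph (up i)),
  H_at i (psi i a) /\ a point point = 1.
Proof.
have [mi|nmi] := pselect (maximal_elt i).
  exists 1; split; last by rewrite cfm1E eqxx.
  by rewrite /H_at asboolT//; exists 1; rewrite ?scale1r.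
exists (munit K point point); split; last by rewrite munitE !eqxx.
by rewrite /H_at asboolF//; exists (munit K point point) => //; exact: FR_munit.
Qed.

(** Directness of the sum: for [i] outside [L], writing [psi i a] over [L] yields a vanishing sum of
    nonzero components at distinct indices, against [sum_entry_neq0]. *)
Lemma H_set_at_inv (L : set I) i :
  (forall z, @H_at K aleph _ I i z -> H_set L z) -> L i.
Proof.
move=> HiL; apply: contrapT => nLi.
have [a [Ha a1]] := H_at_entry1 i.
have [s [f [us sL Hf e]]] := H_set_seq (HiL _ Ha).
have a0 : psi i a != 0.
  apply/eqP => a0.
  have [x xi] := @base_ex aleph _ I i.
  pose g := Defs.glue x (point : X aleph (up i)).
  have xg : linked i x g by exact: linked_glue.
  have : psi i a g g = 0 by rewrite a0.
  rewrite psiE asboolT; last exact: linked_trans (linked_sym xg) xg.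
  by rewrite glueK// a1 => /eqP; rewrite oner_eq0.
have si : i \notin s by apply/negP => /sL.
pose g k := if k == i then - psi i a else f k.
have [|||x [y [_]]] := @sum_entry_neq0 (i :: s) g i.
- by rewrite /= si.
- by rewrite inE eqxx.
- move=> k; rewrite inE /g; case: eqP => [->|_ /= /Hf//] _.
  by rewrite oppr_eq0 -scaleN1r; split=> //; exact: H_atZ.
rewrite big_cons [in X in X + _]/g eqxx.
have -> : \sum_(j <- s) g j = psi i a.
  rewrite e; apply: eq_big_seq => k sk; rewrite /g; case: eqP => // ki.
  by rewrite -ki sk in si.
by rewrite addNr cfm0E eqxx.
Qed.

(** * Components contained in an ideal *)

Section IdealStructure.
Variables (J : set I) (M : ideal (H K aleph J)).

Lemma ideal_psi_sum i (s : seq (X aleph (up i))) (h : X aleph (up i) -> _) :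
  (forall w, ideal_set M (psi i (h w))) ->
  ideal_set M (psi i (\sum_(w <- s) h w)).
Proof.
move=> Mh; apply: (big_ind (fun a => ideal_set M (psi i a))) => //.
  by rewrite psi0; exact: Defs.ideal0.
by move=> a b Ma Mb; rewrite psiD; exact: Defs.idealD.
Qed.

(** The nonzero entry may come from any block, since [z] acts alike on all blocks of [psi i]; [J i]
    puts the required matrix units into the algebra. *)
Lemma ideal_H_at i z x y : J i -> ~ maximal_elt i -> compatible i z ->
  ideal_set M z -> linked i x y -> z x y != 0 -> @H_at K aleph _ I i `<=` M.
Proof.
move=> Ji nmi cz Mz xy zxy; have xi : mc_set x.2 i by case: xy.
pose u := restr i x; pose v := restr i y.
have HJ (a : cfm K (X aleph (up i))) : FR a -> H_set J (psi i a).
  by move=> fa; apply: (H_set_at Ji); rewrite /H_at asboolF//; exists a.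
have Muv : ideal_set M (psi i (munit K u v)).
  (* Sandwiching [z] between diagonal units isolates its entry at [(x, y)], which is invertible. *)
  have -> : psi i (munit K u v) =
      (z x y)^-1 *: (psi i (munit K u u) * z * psi i (munit K v v)).
    rewrite psi_local// -psiM munit_sandwich psiZ scalerA.
    rewrite (localE _ _ cz xi) !restrK ?mulVf ?scale1r//.
  apply: Defs.idealZ; apply: Defs.idealMr; first exact/HJ/FR_munit.
  by apply: Defs.idealMl => //; exact/HJ/FR_munit.
move=> _ /(H_at_nonmaximal nmi)[a fa ->].
have [s ->] := FR_sum_munit fa; apply: ideal_psi_sum => w.
(* Row [w] of [a] is factored through [munit u v], whose image is already in [M]. *)
have -> : psi i (munit K w w * a) =
    psi i (munit K w u) * psi i (munit K u v) * psi i (munit K v w) * psi i a.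
  by rewrite -!psiM !munitM.
apply: Defs.idealMr; first exact: HJ.
apply: Defs.idealMr; first exact/HJ/FR_munit.
by apply: Defs.idealMl => //; exact/HJ/FR_munit.
Qed.

Lemma ideal_contains_minimal (s : seq I) (f : I -> Q) i :
  uniq s -> (forall k, k \in s -> J k) ->
  (forall k, k \in s -> H_at k (f k) /\ f k != 0) ->
  ideal_set M (\sum_(k <- s) f k) ->
  i \in s -> (forall k, k \in s -> ~~ (k < i)%O) ->
  @H_at K aleph _ I i `<=` M.
Proof.
move=> us sJ Hf Mf si imin; have [mi|nmi] := pselect (maximal_elt i).
  have [] := Hf i si; rewrite {1}/H_at asboolT// => -[c _ fi] fi0.
  have c0 : c != 0 by apply: contraNneq fi0 => c0; rewrite -fi c0 scale0r.
  have Hp : H_set J (psi i 1 : Q).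
    apply: (H_set_at (sJ _ si)); rewrite /H_at asboolT//; exists 1 => //.
    by rewrite scale1r.
  (* As [i] is minimal in [s] and maximal in [I], every other index of [s] is incomparable with it,
     and only the component at [i] survives this product. *)
  have Mfi : ideal_set M ((\sum_(k <- s) f k) * psi i 1).
    exact: Defs.idealMr.
  have := Defs.idealZ c^-1 Mfi.
  rewrite mulr_suml (bigD1_seq i)//= big1_seq ?addr0; last first.
    move=> k /andP[ki sk]; have [a ->] := H_at_psi (Hf k sk).1.
    apply: psi_incomparable.
      by have := imin k sk; rewrite lt_neqAle ki.
    by apply: contra ki => /mi ->.
  rewrite -fi -scalerAl -psiM mulr1 scalerA mulVf// scale1r => M1 z.
  by rewrite /H_at asboolT// => -[b _ <-]; exact: Defs.idealZ.
have [x [y [xy fxy]]] := sum_entry_neq0 us si Hf.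
apply: (ideal_H_at (sJ _ si) nmi _ Mf xy fxy).
apply: compatible_sum => k sk; have [a ->] := H_at_psi (Hf k sk).1.
by apply: compatible_psi_nlt; exact: imin.
Qed.

Lemma ideal_contains_components (s : seq I) (f : I -> Q) :
  uniq s -> (forall k, k \in s -> J k) ->
  (forall k, k \in s -> H_at k (f k) /\ f k != 0) ->
  ideal_set M (\sum_(k <- s) f k) ->
  forall k, k \in s -> @H_at K aleph _ I k `<=` M.
Proof.
have [n] := ubnP (size s); elim: n s => // n IHn s sn us sJ Hf Mf k sk.
have [|i si imin] := @ex_minimal _ _ s; first by case: (s) sk.
have HiM := ideal_contains_minimal us sJ Hf Mf si imin.
have [->//|ki] := eqVneq k i.
apply: (IHn (rem i s)).
- by rewrite size_rem// prednK//; case: (s) si.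
- exact: rem_uniq.
- by move=> l /mem_rem; exact: sJ.
- by move=> l /mem_rem; exact: Hf.
- have -> : \sum_(l <- rem i s) f l = \sum_(l <- s) f l + (-1) *: f i.
    by rewrite (big_rem i si) scaleN1r addrAC subrr add0r.
  by apply: Defs.idealD => //; apply/Defs.idealZ/HiM; have [] := Hf i si.
- by rewrite mem_rem_uniq// inE ki.
Qed.

Lemma ideal_lower_closed j l : J j -> J l -> (j <= l)%O ->
  @H_at K aleph _ I l `<=` M -> @H_at K aleph _ I j `<=` M.
Proof.
move=> Jj Jl; rewrite le_eqVlt => /predU1P[->//|jl] HlM.
have [a [Ha a1]] := H_at_entry1 l.
(* On a chain through both indices, the diagonal position [g] lies in a block at [l] and in one at
   [j]; the entry there is [a point point], that is 1. *)
have [|A mA jlA] := @ex_maxchain _ I [set j; l].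
  by move=> x y [|] -> [|] ->; rewrite ?lexx ?(ltW jl); (by left) || by right.
pose b : X aleph I := (point, MaxChain mA).
have bl : mc_set b.2 l by apply: jlA; right.
have bj : mc_set b.2 j by apply: jlA; left.
pose g := Defs.glue b (point : X aleph (up l)).
have bg : linked l b g by exact: linked_glue.
have gg : linked l g g by exact: linked_trans (linked_sym bg) bg.
have gj : mc_set g.2 j by apply: glue_down => //; exact: ltW.
apply: (ideal_H_at (x := g) (y := g) Jj (lt_nonmaximal jl) _ (HlM _ Ha)).
- by apply: compatible_le; exact: ltW.
- by apply: (linked_le (ltW jl)).
- by rewrite psiE asboolT// glueK// a1 oner_eq0.
Qed.

End IdealStructure.

(** * The correspondence between lower subsets and ideals *)

Section Correspondence.
Variable J : set I.

(** Transparent, so that the underlying set is [H_set L] by conversion. *)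
Definition lower_ideal (L : lowerset J) : ideal (H K aleph J).
Proof.
refine (@Ideal _ _ (H K aleph J) (H_set L) (H_setS (@lower_sub _ _ _ L))
  (H_set0 _ _ _) (@H_setD _ _ _ _ _) (@H_setZ _ _ _ _ _) _ _) => a z Ja Lz;
  by have [] := H_setM_lower (@lower_closed _ _ _ L) Ja Lz.
Defined.

Definition ideal_lower (M : ideal (H K aleph J)) : lowerset J.
Proof.
refine (@Lowerset _ _ J [set j | J j /\ @H_at K aleph _ I j `<=` M] _ _).
- by move=> j [].
- by move=> j l Jj [Jl HlM] jl; split=> //; exact: ideal_lower_closed jl HlM.
Defined.

Lemma lower_idealK : cancel lower_ideal ideal_lower.
Proof.
move=> L; apply/lowersetP/seteqP; split=> j /=.
  by move=> [_ HjL]; exact: H_set_at_inv HjL.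
by move=> Lj; split; [exact: lower_sub Lj|move=> z; exact: H_set_at].
Qed.

(** An element of [M] is the sum of its components, and [M] contains all of [H_at k] for each [k] in
    its support. *)
Lemma ideal_lowerK : cancel ideal_lower lower_ideal.
Proof.
move=> M; apply/idealP/seteqP; split=> z /=.
  move: z; apply: H_set_ind; first exact: Defs.ideal0.
    by move=> z w; exact: Defs.idealD.
  by move=> j z [_ HjM] /HjM.
move=> Mz; have [s [f [us sJ Hf ez]]] := H_set_seq (ideal_sub Mz).
rewrite ez in Mz *.
have HM := ideal_contains_components us sJ Hf Mz.
rewrite big_seq; apply: (big_ind (H_set (ideal_lower M))).
- exact: H_set0.
- by move=> ? ?; exact: H_setD.
- move=> k sk; apply: (H_set_at (j := k)); last by have [] := Hf k sk.
  by split; [exact: sJ|exact: HM].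
Qed.

Lemma lower_ideal_le : {mono lower_ideal : L N / (L <= N)%O}.
Proof.
move=> L N; rewrite le_idealE le_lowersetE; apply/asboolP/asboolP => LN.
  move=> j Lj; apply: H_set_at_inv => z Hz; apply: LN.
  exact: H_set_at Lj Hz.
exact: H_setS.
Qed.

End Correspondence.
End Components.

Theorem theorem4p1 (aleph : pointedType) (K : fieldType)
    (d : Order.disp_t) (I : porderType d) (J : set I) :
  infinite_set [set: aleph] ->
  aleph_poset aleph I ->
  has_finite_cofinal_subset I ->
  (exists phi : {lmorphism lowerset J -> ideal (H K aleph J)},
      bijective phi /\
      forall L : lowerset J,
        ideal_set (phi L) = subalg_set (H K aleph (lower_set L))) /\
  (exists phi : {lmorphism ideal (frakB K aleph I) -> lowerset [set: I]},
      bijective phi).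
Proof.
move=> aleph_infinite _ _; split.
  have fK := @lower_idealK K _ _ I aleph_infinite J.
  have gK := @ideal_lowerK K _ _ I aleph_infinite J.
  have fmono := @lower_ideal_le K _ _ I aleph_infinite J.
  have [phi ephi] := order_iso_lmorphism fK gK fmono.
  exists phi; rewrite ephi; split=> //.
  by exists (@ideal_lower K aleph _ I J).
have fK := @lower_idealK K _ _ I aleph_infinite setT.
have gK := @ideal_lowerK K _ _ I aleph_infinite setT.
(* The second isomorphism goes from ideals to lower sets, so monotonicity is transferred to the
   inverse map. *)
have gmono : {mono (@ideal_lower K aleph _ I setT) :
    M N / (M <= N)%O}.
  by move=> M N; rewrite -(lower_ideal_le K aleph_infinite) !gK.
have [phi ephi] := order_iso_lmorphism gK fK gmono.
by exists phi; rewrite ephi; exists (@lower_ideal K aleph _ I setT).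
Qed.
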